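(* For every integer $n \ge 1$, the number of compositions of $n$ with only odd parts is the $n$th Fibonacci number, i.e., $c_o(n) = F_n$.
   Context: The Fibonacci sequence is defined by $F_0 = 0$, $F_1 = 1$, and $F_n = F_{n-1}+F_{n-2}$ for $n \ge 2$. Given a positive integer $n$, a composition of $n$ is an ordered collection (finite sequence) of positive integers, called parts, whose sum is $n$; different orders count as different compositions. $C_o(n)$ denotes the set of compositions of $n$ all of whose parts are odd, and $c_o(n) = |C_o(n)|$. *)

(* Defs.v *)
From HB Require Import structures.
From mathcomp Require Import all_boot.

Set Implicit Arguments.
Unset Strict Implicit.
Unset Printing Implicit Defensive.

Fixpoint fib (n : nat) : nat :=
  match n with
  | 0 => 0
  | 1 => 1
  | (m.+1 as k).+1 => fib k + fib m
  end.

Definition is_composition (n : nat) (s : seq nat) : bool :=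
  all (fun p => 0 < p) s && (sumn s == n).

Record composition (n : nat) : Type := Composition {
  parts :> seq nat;
  _ : is_composition n parts
}.

HB.instance Definition _ (n : nat) := [isSub for @parts n].
HB.instance Definition _ (n : nat) := [Countable of composition n by <:].

(* A composition of n has at most n parts, each at most n, so composition n
   embeds in the finite type {bseq n of 'I_n.+1}. *)
Section CompositionFinite.
Variable n : nat.

Definition bseq_of_composition (c : composition n) : {bseq n of 'I_n.+1} :=
  insub_bseq n [seq inord p | p <- c].

Definition composition_of_bseq (b : {bseq n of 'I_n.+1}) :
    option (composition n) :=
  insub [seq val i | i <- b].

Lemma composition_part_le (s : seq nat) (p : nat) : p \in s -> p <= sumn s.
Proof.
elim: s => //= q s IHs; rewrite inE => /orP[/eqP-> | /IHs le_ps].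
  exact: leq_addr.
exact: leq_trans le_ps (leq_addl _ _).
Qed.

Lemma composition_size_le (s : seq nat) :
  all (fun p => 0 < p) s -> size s <= sumn s.
Proof.
by elim: s => //= q s IHs /andP[q_gt0 /IHs]; rewrite -add1n; apply: leq_add.
Qed.

Lemma bseq_of_compositionK : pcancel bseq_of_composition composition_of_bseq.
Proof.
case=> s s_comp; have /andP[s_pos /eqP s_sum] := s_comp.
rewrite /composition_of_bseq /bseq_of_composition /insub_bseq /=.
have s_size : size s <= n by rewrite -s_sum composition_size_le.
rewrite val_insubd size_map s_size.
have -> : [seq val i | i <- [seq inord p : 'I_n.+1 | p <- s]] = s.
  rewrite -map_comp -[RHS]map_id; apply/eq_in_map => p p_in_s /=.
  by rewrite inordK // ltnS -s_sum composition_part_le.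
exact: insubT.
Qed.

HB.instance Definition _ : isFinite (composition n) :=
  PCanIsFinite bseq_of_compositionK.

End CompositionFinite.

Definition C_o (n : nat) : {set composition n} :=
  [set c : composition n | all odd (parts c)].

Definition c_o (n : nat) : nat := #|C_o n|.

(* Main.v *)
Require Import Defs.
From mathcomp Require Import all_boot.

(** Call a composition with only odd parts an odd composition.  For [n >= 1],
    the odd compositions of [n.+2] split according to their first part.  If it
    is [1], deleting it leaves an arbitrary odd composition of [n.+1].
    Otherwise it is at least [3], and subtracting [2] from it leaves an
    arbitrary odd composition of [n].  So their number satisfies the Fibonacci
    recurrence.

    The second correspondence needs a first part to act on, hence it only
    reaches the nonempty compositions.  The empty composition of [0] is the
    only exception, and discarding it makes the recurrence valid from [n = 0]
    on, with initial values [0 = fib 0] and [1 = fib 1].  The recurrence is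
    therefore run on explicit lists of nonempty odd compositions
    ([odd_comps]): their sizes are Fibonacci numbers by construction, and what
    remains is that they are exhaustive ([mem_odd_comps]) and without
    repetition ([odd_comps_uniq]). *)

Definition add2_head (s : seq nat) : seq nat :=
  if s is p :: s' then p.+2 :: s' else [::].

Fixpoint odd_comps (n : nat) : seq (seq nat) :=
  match n with
  | 0 => [::]
  | 1 => [:: [:: 1]]
  | (m.+1 as k).+1 =>
      [seq 1 :: s | s <- odd_comps k] ++ [seq add2_head s | s <- odd_comps m]
  end.

Lemma odd_compsSS n :
  odd_comps n.+2 =
    [seq 1 :: s | s <- odd_comps n.+1] ++ [seq add2_head s | s <- odd_comps n].
Proof. by []. Qed.

Arguments odd_comps : simpl never.

Lemma add2_head_inj : injective add2_head.
Proof. by case=> [|p s] [|q t] //= [-> ->]. Qed.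

Lemma size_odd_comps n : size (odd_comps n) = fib n.
Proof.
elim/ltn_ind: n => -[|[|n]] IHn //.
by rewrite odd_compsSS size_cat !size_map !IHn.
Qed.

(** The tests [p = 1] and [p >= 3] on the first part tell apart the two
    halves of the list and determine which of the two maps to invert. *)
Lemma mem_odd_comps n s :
  (s \in odd_comps n) = [&& s != [::], all odd s & sumn s == n].
Proof.
elim/ltn_ind: n s => -[|[|n]] IHn s.
- by case: s => [|[|p] s] //=; rewrite addSn andbF.
- case: s => [|[|[|p]] s] //=; rewrite mem_seq1 eqseq_cons ?andbF //=.
  rewrite add1n eqSS.
  (* An odd composition of 0 is empty, as its parts are positive. *)
  by case: s => [|[|p] s] //=; rewrite andbF.
rewrite odd_compsSS mem_cat; apply/orP/and3P.
- case=> /mapP[t]; rewrite IHn // => /and3P[t_neq0 t_odd /eqP t_sum] ->.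
    by split; rewrite //= t_sum.
  case: t t_neq0 t_odd t_sum => //= p t _ /andP[p_odd t_odd] t_sum.
  by rewrite negbK p_odd !addSn t_sum.
- case: s => [|[|[|p]] s] [] //= _.
    rewrite add1n eqSS => s_odd s_sum.
    left; apply: map_f; rewrite IHn // s_odd s_sum !andbT.
    by case: s s_sum {s_odd}.
  rewrite negbK !addSn !eqSS => s_odd s_sum.
  by right; apply/mapP; exists (p :: s); rewrite // IHn //= s_odd s_sum.
Qed.

Lemma odd_comps_uniq n : uniq (odd_comps n).
Proof.
elim/ltn_ind: n => -[|[|n]] IHn //.
rewrite odd_compsSS cat_uniq !map_inj_uniq ?IHn //=; last first.
- by move=> s t [].
- exact: add2_head_inj.
rewrite andbT; apply/hasPn => _ /mapP[s + ->].
rewrite mem_odd_comps => /and3P[s_neq0 s_odd _].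
(* A first part of 1 on the other side would come from a first part of -1. *)
by apply/mapP => -[t _]; case: s s_neq0 s_odd.
Qed.

Theorem proposition2 (n : nat) (hn : 1 <= n) : c_o n = fib n.
Proof.
rewrite -size_odd_comps /c_o cardE -(size_map val).
apply/perm_size/uniq_perm => [||s].
- by rewrite map_inj_uniq ?enum_uniq //; apply: val_inj.
- exact: odd_comps_uniq.
rewrite mem_odd_comps; apply/mapP/and3P => [[c]|[_ s_odd s_sum]].
- rewrite mem_enum inE => c_odd ->; split=> //.
    (* This is where the sum being positive excludes the empty composition. *)
    by case: c c_odd => -[|p t] //= /andP[_ /eqP n0]; rewrite -n0 in hn.
  by case: c c_odd => t /= /andP[].
have s_comp : is_composition n s.
  by rewrite /is_composition s_sum andbT; apply: sub_all s_odd => p; case: p.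
by exists (Composition s_comp); rewrite // mem_enum inE.
Qed.
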